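(* Let $d\geqslant 4$ be an even integer and let $n>1$ be an integer with $n\equiv 1\pmod{d}$. Then \[ \sum_{k=0}^{n-1}[2dk-1]\frac{(q^{-1};q^d)_k^d}{(q^d;q^d)_k^d}q^{\frac{d(d-1)k}{2}} \equiv 0\pmod{\Phi_n(q)^2}. \]
   Context: $q$ is an indeterminate. The $q$-shifted factorial is $(a;q)_k=(1-a)(1-aq)\cdots(1-aq^{k-1})$ (with $(a;q)_0=1$). For any integer $m$ (including negative $m$), $[m]=(1-q^m)/(1-q)$; in particular $[-1]=-1/q$. $\Phi_n(q)$ denotes the $n$-th cyclotomic polynomial. A congruence of rational functions modulo a polynomial $P(q)$, where the denominators are coprime to $P(q)$, means that $P(q)$ divides the numerator of the difference in lowest terms. *)

(* Defs.v *)
From mathcomp Require Import all_boot all_order all_algebra all_field.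
Set Implicit Arguments. Unset Strict Implicit. Unset Printing Implicit Defensive.
Import GRing.Theory.
Local Open Scope ring_scope.

Definition RF := {fraction {poly rat}}.
Notation "x %:F" := (@FracField.tofrac _ x) : ring_scope.

Definition qq : RF := ('X)%:F.

Definition qpoch (a x : RF) (k : nat) : RF := \prod_(i < k) (1 - a * x ^+ i).

Definition qint (m : int) : RF := (1 - qq ^ m) / (1 - qq).

Definition PhiQ (n : nat) : {poly rat} := map_poly intr ('Phi_n).

(* x = y (mod P): x - y = a/b with b nonzero, coprime to P and P | a
   (equivalently, P divides the numerator of x - y in lowest terms). *)
Definition cong_mod (x y : RF) (P : {poly rat}) : Prop :=
  exists a b : {poly rat},
    [/\ b != 0, coprimep b P, x - y = a%:F / b%:F & P %| a].

(* Main.v *)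
(** Put Q = q^d, a = 1/q, E = (d-1)n, y = q^E, and M = n - (n-1)/d, so that Q^M = y/a.  The terms
    with k > M contain Phi_n^d.  In the other ones, replace one pair of parameters (a, a) by
    (a y, a / y); since (1 - x y)(1 - x / y) = (1 - x)^2 - x (1 - y)^2 / y and Phi_n | 1 - y, this does
    not change the sum modulo Phi_n^2.  The new sum is well-poised and terminates at M; up to the
    factor (1 - a) (Q;Q)_M (a Q;Q)_M it is the entry beta_M of the Bailey pair obtained
    from the unit Bailey pair relative to a by (d-4)/2 steps of Bailey's lemma with parameters (a, a)
    and one step with parameters (a, a y).  The factor (a Q;Q)_M is divisible by Phi_n.  So is
    beta_M: by induction on the steps, beta_j after s steps is divisible by Phi_n
    for j > s ((n-1)/d - 1), because (q Q;Q)_i is divisible by Phi_n for i >= (n-1)/d. *)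

Require Import Defs.
From mathcomp Require Import all_boot all_order all_algebra all_field.
From mathcomp Require Import ring zify.
Import GRing.Theory.
Local Open Scope ring_scope.

Ltac field_nz := field; do ?[apply/andP; split]; rewrite ?oner_neq0.

(** * q-shifted factorials over a field *)

Section BaileyChain.
Variable F : fieldType.
Implicit Types (a b c q y l x : F) (alpha beta : nat -> F).

Definition poch a q k : F := \prod_(i < k) (1 - a * q ^+ i).

Lemma poch0 a q : poch a q 0 = 1.
Proof. by rewrite /poch big_ord0. Qed.

Lemma pochS a q k : poch a q k.+1 = poch a q k * (1 - a * q ^+ k).
Proof. by rewrite /poch big_ord_recr. Qed.

Lemma pochD a q k j : poch a q (k + j) = poch a q k * poch (a * q ^+ k) q j.
Proof.
elim: j => [|j IH]; first by rewrite addn0 poch0 mulr1.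
by rewrite addnS !pochS IH -!mulrA -exprD.
Qed.

Lemma poch_neq0 a q k : (forall i, 1 - a * q ^+ i != 0) -> poch a q k != 0.
Proof. by move=> h; apply/prodf_neq0 => i _. Qed.

(** * The q-Pfaff-Saalschütz sum *)

Definition saalschutz_term b c l q n i : F := poch b q i * poch c q i * poch l q (n - i) * l ^+ i
  / (poch q q (n - i) * poch q q i * poch (l * b * c) q i).

(** A creative-telescoping certificate: the first-order recurrence in [n] expected of the sum holds
    termwise up to a difference in [i], so its partial sums have a closed form, found by induction
    on [k]. *)
Lemma saalschutz_telescope b c l q n k :
  (forall i, 1 - q * q ^+ i != 0) -> (forall i, 1 - l * b * c * q ^+ i != 0) ->
  q != 0 -> (k <= n)%N ->
  \sum_(i < k.+1) ((1 - q * q ^+ n) * (1 - l * b * c * q ^+ n) * saalschutz_term b c l q n.+1 i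
     - (1 - l * b * q ^+ n) * (1 - l * c * q ^+ n) * saalschutz_term b c l q n i)
  = - (l * (q ^+ n / q ^+ k) * (1 - b * q ^+ k) * (1 - c * q ^+ k)) * saalschutz_term b c l q n k.
Proof.
move=> hq hC q0; elim: k => [_|k IH kn].
  rewrite big_ord_recr big_ord0 /= add0r /saalschutz_term !subn0 !pochS !poch0 !expr0.
  have := hq n; have := poch_neq0 _ _ n hq; move: (poch q q n) (q ^+ n) => u v ??.
  by field_nz.
rewrite big_ord_recr /= IH ?(ltnW kn) // /saalschutz_term.
(* Writing [n] as [k.+1 + e] turns the truncated differences into successors; all factorials then
   expand over common ones and a rational identity remains. *)
have [e ->] : exists e, n = (k.+1 + e)%N by exists (n - k.+1)%N; rewrite subnKC.
have -> : ((k.+1 + e).+1 - k.+1 = e.+1)%N by rewrite -addnS addKn.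
have -> : (k.+1 + e - k.+1 = e)%N by rewrite addKn.
have -> : (k.+1 + e - k = e.+1)%N by rewrite addSnnS addKn.
rewrite !pochS !exprD !exprS.
have := hq e; have := hq k; have := hC k; have := poch_neq0 _ _ k hC.
have := poch_neq0 _ _ e hq; have := poch_neq0 _ _ k hq.
have := expf_neq0 k q0; have := expf_neq0 e q0.
move: (poch q q k) (poch q q e) (poch (l * b * c) q k) (poch b q k) (poch c q k)
  (poch l q e) (q ^+ k) (q ^+ e) (l ^+ k) => *.
by field_nz.
Qed.

(** The terminating balanced 3φ2 sum, with the usual factors (q^-n;q)_i and (q^(1-n)/l;q)_i absorbed
    in (l;q)_(n-i) / (q;q)_(n-i). In the induction, the boundary term of the telescoping at [k = n]
    cancels the extra term [i = n.+1], leaving a first-order recurrence in [n]. *)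
Lemma q_pfaff_saalschutz b c l q n :
  (forall i, 1 - q * q ^+ i != 0) -> (forall i, 1 - l * b * c * q ^+ i != 0) ->
  q != 0 ->
  \sum_(i < n.+1) saalschutz_term b c l q n i
  = poch (l * b) q n * poch (l * c) q n / (poch q q n * poch (l * b * c) q n).
Proof.
move=> hq hC q0; elim: n => [|n IH].
  by rewrite big_ord_recr big_ord0 /= /saalschutz_term !poch0 add0r !mulr1 invr1 mulr1.
have /eqP := saalschutz_telescope b c l q n n hq hC q0 (leqnn n).
rewrite sumrB -!mulr_sumr IH subr_eq => /eqP.
set S := \sum_(i < n.+1) _ => HS.
have hcoef : (1 - q * q ^+ n) * (1 - l * b * c * q ^+ n) != 0 by rewrite mulf_neq0.
have -> : \sum_(i < n.+2) saalschutz_term b c l q n.+1 i = S + saalschutz_term b c l q n.+1 n.+1.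
  by rewrite big_ord_recr.
apply: (mulfI hcoef); rewrite mulrDr HS /saalschutz_term !subnn !poch0 !pochS exprS.
have := hq n; have := hC n; have := poch_neq0 _ _ n hC.
have := poch_neq0 _ _ n hq; have := expf_neq0 n q0.
move: (poch q q n) (poch (l * b * c) q n) (poch b q n) (poch c q n) (poch (l * b) q n)
  (poch (l * c) q n) (q ^+ n) (l ^+ n) => *.
by field_nz.
Qed.

(** * Bailey pairs, Bailey's lemma and the unit Bailey pair *)

Definition bailey_pair a q alpha beta := forall n,
  beta n = \sum_(r < n.+1) alpha r / (poch q q (n - r) * poch (a * q) q (n + r)).

(* The Bailey step with parameters b, c, where l stands for a q / (b c); thus a q / b = l c
   and a q / c = l b. *)
Definition bailey_alpha b c l q alpha r : F :=
  poch b q r * poch c q r * l ^+ r / (poch (l * c) q r * poch (l * b) q r) * alpha r.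

Definition bailey_beta b c l q beta n : F :=
  \sum_(j < n.+1) poch b q j * poch c q j * poch l q (n - j) * l ^+ j
    / (poch q q (n - j) * poch (l * b) q n * poch (l * c) q n) * beta j.

(** After exchanging the sums, the inner sum over j = r + i is a q-Pfaff-Saalschütz sum with b, c, n
    replaced by b q^r, c q^r, n - r; [l] is unchanged and l b c becomes a q^(2r+1). *)
Lemma bailey_lemma a b c l q alpha beta :
  (forall i, 1 - q * q ^+ i != 0) -> (forall i, 1 - a * q * q ^+ i != 0) ->
  (forall i, 1 - l * b * q ^+ i != 0) -> (forall i, 1 - l * c * q ^+ i != 0) ->
  q != 0 -> l * b * c = a * q ->
  bailey_pair a q alpha beta ->
  bailey_pair a q (bailey_alpha b c l q alpha) (bailey_beta b c l q beta).
Proof.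
move=> hq ha hb hc q0 labc H n; rewrite /bailey_beta.
under eq_bigr => j _ do rewrite H mulr_sumr.
pose G (j r : nat) := poch b q j * poch c q j * poch l q (n - j) * l ^+ j
    / (poch q q (n - j) * poch (l * b) q n * poch (l * c) q n)
    * (alpha r / (poch q q (j - r) * poch (a * q) q (j + r))).
have -> : \sum_(j < n.+1) \sum_(r < j.+1) G j r
        = \sum_(0 <= j < n.+1) \sum_(0 <= r < n.+1 | (r <= j)%N) G j r.
  rewrite big_mkord; apply: eq_bigr => j _.
  by rewrite (big_ord_widen n.+1 (fun r => G j r)) // big_mkord.
rewrite (exchange_big_dep_nat xpredT) //= big_mkord; apply: eq_bigr => -[r /= rn] _.
rewrite ltnS in rn.
rewrite (big_cat_nat _ (n := r)) //=; last exact: leqW.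
rewrite big_nat_cond big1 ?add0r; last by move=> j /andP[/andP[_ jr]]; rewrite leqNgt jr.
rewrite [LHS](_ : _ = \sum_(r <= j < n.+1) G j r); last first.
  rewrite big_nat_cond [RHS]big_nat_cond; apply: eq_bigl => j.
  by rewrite andbT andbC andbA andbb.
rewrite -{1}[r]add0n big_addn subSn // big_mkord.
have hC i : 1 - l * (b * q ^+ r) * (c * q ^+ r) * q ^+ i != 0.
  have := ha (r + r + i)%N; rewrite !exprD !mulrA; congr (1 - _ != 0).
  by rewrite -labc; ring.
have := q_pfaff_saalschutz (b * q ^+ r) (c * q ^+ r) l q (n - r) hq hC q0.
rewrite /saalschutz_term.
have -> : l * (b * q ^+ r) * (c * q ^+ r) = a * q * q ^+ (r + r).
  by rewrite exprD -labc; ring.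
move=> HS.
transitivity (poch b q r * poch c q r * l ^+ r * alpha r /
   (poch (l * b) q n * poch (l * c) q n * poch (a * q) q (r + r)) *
   (\sum_(i < (n - r).+1) poch (b * q ^+ r) q i * poch (c * q ^+ r) q i
     * poch l q (n - r - i) * l ^+ i
  / (poch q q (n - r - i) * poch q q i * poch (a * q * q ^+ (r + r)) q i))).
  rewrite mulr_sumr; apply: eq_bigr => -[i /= _] _; rewrite /G.
  rewrite [(i + r)%N]addnC subnDA addKn addnAC !(pochD _ _ r i) (pochD _ _ (r + r) i) exprD.
  rewrite !invfM; ring.
rewrite HS /bailey_alpha.
have -> : (n + r = (r + r) + (n - r))%N by rewrite -addnA subnKC // addnC.
rewrite (pochD (a * q) _ (r + r)).
have Hn x : poch x q n = poch x q r * poch (x * q ^+ r) q (n - r).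
  by rewrite -pochD subnKC.
rewrite !Hn !mulrA.
have hbr i : 1 - l * b * q ^+ r * q ^+ i != 0 by have := hb (r + i)%N; rewrite exprD mulrA.
have hcr i : 1 - l * c * q ^+ r * q ^+ i != 0 by have := hc (r + i)%N; rewrite exprD mulrA.
have har i : 1 - a * q * q ^+ (r + r) * q ^+ i != 0.
  by have := ha (r + r + i)%N; rewrite exprD mulrA.
have := poch_neq0 _ _ (n - r) hbr; have := poch_neq0 _ _ (n - r) hcr.
have := poch_neq0 _ _ (n - r) har; have := poch_neq0 _ _ (n - r) hq.
have := poch_neq0 _ _ (r + r) ha; have := poch_neq0 _ _ r hb; have := poch_neq0 _ _ r hc.
move: (poch (l * b * _) _ _) (poch (l * c * _) _ _) (poch _ q (n - r))
 (poch _ q (n - r)) (poch (a * q) _ _) (poch (l * b) _ _) (poch (l * c) _ _)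
 (poch b _ _) (poch c _ _) => *.
by field_nz.
Qed.

(** The product of the - q^i is (-1)^r q^(r(r-1)/2), written so that it grows by one factor at each
    induction step. *)
Definition unit_alpha a q r : F :=
  poch a q r * (1 - a * q ^+ (2 * r)) * \prod_(i < r) - q ^+ i
    / ((1 - a) * poch q q r).

Lemma unit_bailey_pair a q :
  (forall i, 1 - q * q ^+ i != 0) -> (forall i, 1 - a * q * q ^+ i != 0) -> 1 - a != 0 ->
  bailey_pair a q (unit_alpha a q) (fun n => (n == 0%N)%:R).
Proof.
move=> hq ha a1 [|n].
  rewrite big_ord_recr big_ord0 /= /unit_alpha !poch0 big_ord0 muln0 expr0.
  by field_nz.
(* Closed form of the partial sums of the sum for index [n.+1]. It stops at [k = n], where
   (q;q)_(n-k) is still meaningful; the last term, r = n + 1, cancels the partial sum up to n. *)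
have part k : (k <= n)%N ->
  \sum_(r < k.+1) unit_alpha a q r / (poch q q (n.+1 - r) * poch (a * q) q (n.+1 + r))
  = poch (a * q) q k * (\prod_(i < k) - q ^+ i) * q ^+ k
    / (poch q q k * poch q q (n - k) * poch (a * q) q (n.+1 + k) * (1 - q * q ^+ n)).
  elim: k => [_|k IH kn].
    rewrite big_ord_recr big_ord0 /= /unit_alpha !poch0 big_ord0 muln0 expr0 !subn0 pochS.
    have := hq n; have := poch_neq0 _ _ n hq; have := poch_neq0 _ _ (n.+1 + 0) ha.
    move: (poch q q n) (poch (a * q) _ _) => *.
    by field_nz.
  rewrite big_ord_recr /= IH ?(ltnW kn) // /unit_alpha.
  have [e ->] : exists e, n = (k.+1 + e)%N by exists (n - k.+1)%N; rewrite subnKC.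
  have -> : ((k.+1 + e).+1 - k.+1 = e.+1)%N by rewrite -addnS addKn.
  have -> : (k.+1 + e - k.+1 = e)%N by rewrite addKn.
  have -> : (k.+1 + e - k = e.+1)%N by rewrite addSnnS addKn.
  have -> : poch a q k.+1 = (1 - a) * poch (a * q) q k.
    by rewrite -[k.+1]add1n pochD pochS poch0 expr0 expr1 mulr1 mul1r.
  have [p Hp] : exists p, p = (k + k + e)%N by exists (k + k + e)%N.
  have -> : ((k.+1 + e).+1 + k.+1 = p.+3)%N by rewrite Hp; lia.
  have -> : ((k.+1 + e).+1 + k = p.+2)%N by rewrite Hp; lia.
  rewrite !big_ord_recr /= !pochS.
  have := hq e; have := hq k; have := ha k; have := hq (k.+1 + e)%N.
  have := ha p.+2; have := ha p.+1; have := ha p; have := poch_neq0 _ _ p ha.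
  rewrite (mulnDr 2 1 k : 2 * k.+1 = _)%N mul2n -addnn !(exprD, exprS, expr0) Hp !exprD.
  have := poch_neq0 _ _ k hq; have := poch_neq0 _ _ e hq.
  rewrite -Hp.
  move: (poch q q k) (poch q q e) (poch (a * q) q k) (poch (a * q) q p)
     (q ^+ k) (q ^+ e) (\prod_(i < k) _) => *.
  by field_nz.
rewrite big_ord_recr /= part // subnn poch0 /unit_alpha subnn poch0 !big_ord_recr /=.
have -> : poch a q n.+1 = (1 - a) * poch (a * q) q n.
  by rewrite -[n.+1]add1n pochD pochS poch0 expr0 expr1 mulr1 mul1r.
have [p Hp] : exists p, p = (n + n)%N by exists (n + n)%N.
have -> : (n.+1 + n.+1 = p.+2)%N by rewrite Hp; lia.
have -> : (n.+1 + n = p.+1)%N by rewrite Hp; lia.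
rewrite !pochS.
have := hq n; have := ha p.+1; have := ha p; have := poch_neq0 _ _ p ha.
have := poch_neq0 _ _ n hq.
rewrite (mulnDr 2 1 n : 2 * n.+1 = _)%N mul2n -addnn !(exprD, exprS, expr0) Hp !exprD -Hp.
move: (poch q q n) (poch (a * q) q n) (poch (a * q) q p) (q ^+ n) (\prod_(i < n) _) => *.
by field_nz.
Qed.

(** * The Bailey chain and the terminating well-poised sum *)

Definition chain_beta a q t : nat -> F :=
  iter t (bailey_beta a a (q / a) q) (fun n => (n == 0%N)%:R).

Lemma iter_bailey_alpha b c l q alpha t r :
  iter t (bailey_alpha b c l q) alpha r
  = (poch b q r * poch c q r * l ^+ r / (poch (l * c) q r * poch (l * b) q r)) ^+ t
    * alpha r.
Proof.
elim: t => [|t IH]; first by rewrite mul1r.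
by rewrite iterS {1}/bailey_alpha IH mulrA -exprS.
Qed.

(** Reversal of a q-factorial: a/y is q^-M, so (a/y;q)_k consists, up to signs and powers of q, of
    the top k factors of (q;q)_M. *)
Lemma poch_reverse a q y M k : q != 0 -> a != 0 -> y != 0 -> q ^+ M = y / a ->
  (k <= M)%N ->
  poch q q M * \prod_(i < k) - q ^+ i
  = poch q q (M - k) * (y / a) ^+ k * poch (a / y) q k.
Proof.
move=> q0 a0 y0 qM; elim: k => [_|k IH kM].
  by rewrite subn0 big_ord0 poch0 !mulr1.
rewrite big_ord_recr /= mulrA IH ?(ltnW kM) // pochS exprS.
have [e He] : exists e, M = (k + e.+1)%N.
  by exists (M - k.+1)%N; rewrite addnS -addSn subnKC.
have -> : (M - k = e.+1)%N by rewrite He addKn.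
have -> : (M - k.+1 = e)%N by rewrite He; lia.
have qk := expf_neq0 k q0.
have Hqe : q * q ^+ e = y / a / q ^+ k by rewrite -qM He exprD exprS; field.
rewrite pochS Hqe; move: (poch q q e) (poch (a / y) q k) (_ ^+ k) qk => *.
by field_nz.
Qed.

(** The Bailey pair relation at index [M], multiplied out. As q^M = y/a, the factor 1/(q;q)_(M-k)
    yields (a/y;q)_k, and (aq;q)_(M+k) splits off (qy;q)_k; the last step, with parameters a and ay,
    supplies (ay;q)_k and (q/y;q)_k. *)
Lemma chain_identity a q y M t :
  (forall i, 1 - q * q ^+ i != 0) -> (forall i, 1 - a * q * q ^+ i != 0) -> 1 - a != 0 ->
  (forall i, 1 - q / y * q ^+ i != 0) ->
  q != 0 -> a != 0 -> y != 0 -> q ^+ M = y / a ->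
  \sum_(k < M.+1) (1 - a * q ^+ (2 * k)) * poch a q k ^+ (2 * t.+1)
     * (poch (a * y) q k * poch (a / y) q k)
     / (poch q q k ^+ (2 * t.+1) * (poch (q * y) q k * poch (q / y) q k))
     * (q ^+ t.+1 / a ^+ t.+2) ^+ k
  = (1 - a) * poch q q M * poch (a * q) q M
    * bailey_beta a (a * y) (q / (a * y)) q (chain_beta a q t) M.
Proof.
move=> hq ha a1 hy q0 a0 y0 qM.
have chain : bailey_pair a q (iter t (bailey_alpha a a (q / a) q) (unit_alpha a q))
   (chain_beta a q t).
  elim: (t) => [|u IH]; first exact: unit_bailey_pair.
  by apply: bailey_lemma => // [i|i|]; rewrite ?divfK //; field_nz.
have lb : q / (a * y) * a = q / y by field_nz.
have lc : q / (a * y) * (a * y) = q by field_nz.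
have := bailey_lemma a a (a * y) (q / (a * y)) q _ _ hq ha _ _ q0 _ chain.
rewrite lb lc => /(_ hy hq) -> //; last by field_nz.
rewrite mulr_sumr; apply: eq_bigr => -[k /= kM] _; rewrite ltnS in kM.
rewrite /bailey_alpha lb lc iter_bailey_alpha divfK // /unit_alpha.
rewrite pochD.
have -> : a * q * q ^+ M = q * y by rewrite qM; field_nz.
have hr := poch_reverse a q y M k q0 a0 y0 qM kM.
have hqy i : 1 - q * y * q ^+ i != 0.
  have := ha (M + i)%N; rewrite exprD qM; congr (1 - _ != 0); by field_nz.
have pw x : x ^+ (2 * t.+1) = x ^+ t * x ^+ t * (x * x).
  by rewrite mul2n -addnn exprD !exprS; ring.
have -> : (q ^+ t.+1 / a ^+ t.+2) ^+ k
   = (q ^+ k) ^+ t * q ^+ k / ((a ^+ k) ^+ t * a ^+ k * a ^+ k).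
  rewrite expr_div_n -!exprM !mulSn !exprD [(t * k)%N]mulnC.
  by congr (_ / _); ring.
have hr' : \prod_(i < k) - q ^+ i =
   poch q q (M - k) * (y / a) ^+ k * poch (a / y) q k / poch q q M.
  by rewrite -hr [poch q q M * _]mulrC mulfK // poch_neq0.
rewrite hr' !pw !(exprMn, exprVn).
have := expf_neq0 t (expf_neq0 k q0); have := expf_neq0 t (expf_neq0 k a0).
have := expf_neq0 k a0; have := expf_neq0 k y0; have := expf_neq0 k q0.
have := poch_neq0 _ _ M hq; have := poch_neq0 _ _ M ha.
have := poch_neq0 _ _ (M - k) hq; have := poch_neq0 _ _ k hqy.
have := poch_neq0 _ _ k hy; have := expf_neq0 t (poch_neq0 _ _ k hq).
have := poch_neq0 _ _ k hq; clear -a1.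
move: (poch q q M) (poch q q k) (poch q q (M - k)) (poch (a * q) q M)
  (poch (a * y) q k) (poch (a / y) q k) (poch (q * y) q k) (poch (q / y) q k)
  (poch a q k) (a ^+ k) (q ^+ k) (y ^+ k) (q ^+ (2 * k)) => qM qk qMk aqM ay ay' qy qy' pa.
move=> ak q_k yk q2k.
move: (qk ^+ t) (pa ^+ t) (q_k ^+ t) (ak ^+ t) => *.
by field_nz.
Qed.

End BaileyChain.

(** * Identities for replacing a pair (x, x) by (x y, x / y) *)

Lemma poch_sym_identity (F : fieldType) (x y z p p1 p2 : F) : y != 0 ->
  (p * (1 - x * z)) ^+ 2 - p1 * (1 - x * y * z) * (p2 * (1 - x / y * z))
  = (p ^+ 2 - p1 * p2) * (1 - x * z) ^+ 2 + p1 * p2 * (x * z / y) * (1 - y) ^+ 2.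
Proof. by move=> y0; field_nz. Qed.

(** Compares a term with its deformation: [p] stands for the deformed x^2 and [r] for the deformed
    z^2, so the difference is small as soon as [x ^+ 2 - p] and [r - z ^+ 2] are. *)
Lemma diff_square_ratio (F : fieldType) (c x z p r w : F) e : z != 0 -> r != 0 ->
  c * x ^+ (e + 2) / z ^+ (e + 2) * w - c * x ^+ e * p / (z ^+ e * r) * w
  = c * x ^+ e / z ^+ e * w * (((x ^+ 2 - p) * r + p * (r - z ^+ 2)) / (z ^+ 2 * r)).
Proof.
move=> z0 r0; rewrite !exprD; have := expf_neq0 e z0.
by move: (x ^+ e) (z ^+ e) => u v v0; field_nz.
Qed.

(** * The localization of the rational functions at a polynomial [P] *)

Section Localization.
Variables (F : fieldType) (f : {rmorphism {poly rat} -> F}).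
Hypothesis f_inj : injective f.

Section PAdic.
Variable P : {poly rat}.
Implicit Types x y z : F.

(* The P-adic valuation of x is at least j (x lying in the localization at P if j = 0). *)
Definition vge (j : nat) (x : F) : Prop := exists u v : {poly rat},
  [/\ v != 0, coprimep v P & x = f (P ^+ j * u) / f v].

Definition vunit x := [/\ x != 0, vge 0 x & vge 0 x^-1].

Lemma fmorph_poly_neq0 (p : {poly rat}) : p != 0 -> f p != 0.
Proof. by apply: contraNneq => fp; apply/eqP/f_inj; rewrite fp rmorph0. Qed.

Lemma vge_poly j (u : {poly rat}) : vge j (f (P ^+ j * u)).
Proof. by exists u, 1; rewrite oner_neq0 coprime1p rmorph1 divr1. Qed.

Lemma vge0 j : vge j 0.
Proof. by have := vge_poly j 0; rewrite mulr0 rmorph0. Qed.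

Lemma vge_one : vge 0 1.
Proof. by have := vge_poly 0 1; rewrite mulr1 rmorph1. Qed.

Lemma vgeD j x y : vge j x -> vge j y -> vge j (x + y).
Proof.
move=> [u [v [v0 cv ->]]] [u' [v' [v0' cv' ->]]].
exists (u * v' + u' * v), (v * v'); split; first by rewrite mulf_neq0.
  by rewrite coprimepMl cv.
by rewrite addf_div ?fmorph_poly_neq0 // -!rmorphM -rmorphD mulrDr !mulrA.
Qed.

Lemma vgeM i j x y : vge i x -> vge j y -> vge (i + j) (x * y).
Proof.
move=> [u [v [v0 cv ->]]] [u' [v' [v0' cv' ->]]].
exists (u * u'), (v * v'); split; first by rewrite mulf_neq0.
  by rewrite coprimepMl cv.
by rewrite mulf_div -!rmorphM exprD mulrACA.
Qed.

Lemma vgeMl j x y : vge 0 x -> vge j y -> vge j (x * y).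
Proof. exact: vgeM. Qed.

Lemma vgeMr j x y : vge j x -> vge 0 y -> vge j (x * y).
Proof. by rewrite mulrC => ??; apply: vgeMl. Qed.

Lemma vgeN j x : vge j x -> vge j (- x).
Proof.
move=> [u [v [v0 cv ->]]]; exists (- u), v; split=> //.
by rewrite mulrN rmorphN mulNr.
Qed.

Lemma vgeB j x y : vge j x -> vge j y -> vge j (x - y).
Proof. by move=> hx hy; apply: vgeD => //; apply: vgeN. Qed.

Lemma vgeW i j x : (i <= j)%N -> vge j x -> vge i x.
Proof.
move=> ij [u [v [v0 cv ->]]]; exists (P ^+ (j - i) * u), v; split=> //.
by rewrite mulrA -exprD subnKC.
Qed.

Lemma vge_sum j (I : Type) (r : seq I) (p : pred I) (g : I -> F) :
  (forall i, p i -> vge j (g i)) -> vge j (\sum_(i <- r | p i) g i).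
Proof. by move=> h; apply: big_ind => //; [exact: vge0 | exact: vgeD]. Qed.

Lemma vge_prod0 (I : Type) (r : seq I) (p : pred I) (g : I -> F) :
  (forall i, p i -> vge 0 (g i)) -> vge 0 (\prod_(i <- r | p i) g i).
Proof. by move=> h; apply: big_ind => //; [exact: vge_one | exact: (@vgeM 0 0)]. Qed.

Lemma vgeX j k x : vge j x -> vge (j * k) (x ^+ k).
Proof.
move=> hx; elim: k => [|k IH]; first by rewrite muln0; apply: vge_one.
by rewrite mulnS exprS; apply: vgeM.
Qed.

Lemma vge_poch0 (x y : F) k : vge 0 x -> vge 0 y -> vge 0 (poch _ x y k).
Proof.
move=> hx hy; apply: vge_prod0 => i _; apply: vgeB; first exact: vge_one.
by apply: vgeMl => //; apply: (@vgeX 0).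
Qed.

Lemma vge_poch1 (x y : F) k i : (i < k)%N -> vge 0 x -> vge 0 y ->
  vge 1 (1 - x * y ^+ i) -> vge 1 (poch _ x y k).
Proof.
move=> ik hx hy h1; rewrite -(subnKC ik) pochD; apply: vgeMr.
  by rewrite pochS; apply: vgeMl h1; apply: vge_poch0.
by apply: vge_poch0 => //; apply: vgeMl => //; apply: (@vgeX 0).
Qed.

Lemma vunit_vge0 x : vunit x -> vge 0 x.
Proof. by case. Qed.

Lemma vunitV x : vunit x -> vunit x^-1.
Proof. by case=> *; split; rewrite ?invr_eq0 ?invrK. Qed.

Lemma vunit1 : vunit 1.
Proof. by split; rewrite ?invr1 ?oner_neq0 //; apply: vge_one. Qed.

Lemma vunitM x y : vunit x -> vunit y -> vunit (x * y).
Proof.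
by case=> ???[???]; split; rewrite ?mulf_neq0 // ?invfM; apply: (@vgeM 0 0).
Qed.

Lemma vunitX x k : vunit x -> vunit (x ^+ k).
Proof.
move=> hx; elim: k => [|k IH]; [exact: vunit1 | rewrite exprS; exact: vunitM].
Qed.

Lemma vunit_poly (p : {poly rat}) : p != 0 -> coprimep p P -> vunit (f p).
Proof.
move=> p0 cp; split; first exact: fmorph_poly_neq0.
  by have := vge_poly 0 p; rewrite mul1r.
by exists 1, p; rewrite mulr1 rmorph1 mul1r.
Qed.

Lemma vunit_poch (x y : F) k : (forall i, (i < k)%N -> vunit (1 - x * y ^+ i)) ->
  vunit (poch _ x y k).
Proof.
elim: k => [|k IH] h; first by rewrite poch0; apply: vunit1.
by rewrite pochS; apply: vunitM; [apply: IH => i ik; apply: h; apply: leqW | apply: h].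
Qed.

(** By [poch_sym_identity], going from k to k + 1 multiplies the difference by a square and adds a
    multiple of (1 - y)^2. *)
Lemma vge_poch_sym (x y q : F) k : vge 0 x -> vge 0 q -> vunit y -> vge 1 (1 - y) ->
  vge 2 (poch _ x q k ^+ 2 - poch _ (x * y) q k * poch _ (x / y) q k).
Proof.
move=> hx hq hy h1; elim: k => [|k IH].
  by rewrite !poch0 mulr1 expr1n subrr; apply: vge0.
have [y0 hy0 hy1] := hy.
rewrite !pochS; set p := poch _ _ _ _; set p1 := poch _ _ _ _; set p2 := poch _ _ _ _.
rewrite poch_sym_identity //.
have hqk : vge 0 (q ^+ k) by apply: (@vgeX 0).
have hxq : vge 0 (x * q ^+ k) by apply: vgeMl.
apply: vgeD.
  apply: vgeMr => //; apply: (@vgeX 0); apply: vgeB => //; exact: vge_one.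
apply: vgeMl; last exact: (@vgeX 1 2).
by do ?[apply: vgeMl] => //; apply: vge_poch0 => //; apply: vgeMl.
Qed.

End PAdic.

(** * Divisibility by [P] along the Bailey chain *)

Lemma bailey_beta_vge (P : {poly rat}) (b c l q : F) (beta : nat -> F) (N m K : nat) :
  vge P 0 b -> vge P 0 c -> vge P 0 l -> vge P 0 q -> vge P 1 (1 - l * q ^+ m) ->
  (forall j, (j <= N)%N -> [/\ vunit P (poch _ q q j), vunit P (poch _ (l * b) q j)
      & vunit P (poch _ (l * c) q j)]) ->
  (forall j, (j <= N)%N -> vge P 0 (beta j) /\ ((K < j)%N -> vge P 1 (beta j))) ->
  forall j, (j <= N)%N -> vge P 0 (bailey_beta _ b c l q beta j)
     /\ ((K + m < j)%N -> vge P 1 (bailey_beta _ b c l q beta j)).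
Proof.
move=> hb hc hl hq hm hU hbeta j jN.
have hin (i : 'I_j.+1) : (i <= j)%N by rewrite -ltnS.
have hden (i : 'I_j.+1) :
    vge P 0 (poch _ q q (j - i) * poch _ (l * b) q j * poch _ (l * c) q j)^-1.
  have [h1 _ _] := hU (j - i)%N (leq_trans (leq_subr _ _) jN).
  have [_ h2 h3] := hU j jN.
  by apply: vunit_vge0; apply: vunitV; apply: vunitM => //; apply: vunitM.
have hli (i : nat) : vge P 0 (l ^+ i) by apply: (@vgeX P 0).
have hp x i : vge P 0 x -> vge P 0 (poch _ x q i) by move=> hx; apply: vge_poch0.
split=> [|Kj]; apply: vge_sum => i _.
  have [hbi _] := hbeta i (leq_trans (hin i) jN).
  by apply: vgeMl => //; apply: vgeMl => //; do ?[apply: vgeMl] => //; apply: hp.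
have [hbi0 hbi1] := hbeta i (leq_trans (hin i) jN).
(* Either i > K and beta_i is divisible by [P], or j - i > m and (l;q)_(j-i) contains the divisible
   factor 1 - l q^m. *)
case: (ltnP K i) => Ki.
  apply: vgeMl; last exact: hbi1.
  by apply: vgeMl => //; do ?[apply: vgeMl] => //; apply: hp.
apply: vgeMr => //; apply: vgeMr => //; apply: vgeMr => //; apply: vgeMl.
  by apply: vgeMl; apply: hp.
by apply: (vge_poch1 _ _ _ _ m) => //; have := hin i; lia.
Qed.

(** The unit beta vanishes beyond index 0, and each step, having l = q/a, raises the threshold by
    [m]. *)
Lemma chain_beta_vge (P : {poly rat}) (a q : F) (N m t : nat) :
  vge P 0 a -> vunit P a -> vge P 0 q -> vge P 1 (1 - q / a * q ^+ m) ->
  (forall j, (j <= N)%N -> vunit P (poch _ q q j)) ->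
  forall j, (j <= N)%N -> vge P 0 (chain_beta _ a q t j)
     /\ ((t * m < j)%N -> vge P 1 (chain_beta _ a q t j)).
Proof.
move=> ha ua hq hm hU; elim: t => [|t IH].
  move=> [|j] _ /=; split=> //.
  - exact: vge_one.
  - exact: vge0.
  - by move=> _; apply: vge0.
have [a0 _ hV] := ua.
rewrite mulSnr; apply: bailey_beta_vge => //; first exact: vgeMl.
by move=> j jN; rewrite divfK //; split; apply: hU.
Qed.

(** * Divisibility of binomials in q by the cyclotomic polynomial *)

Section Cyclotomic.
Variable n : nat.
Hypothesis n_gt0 : (0 < n)%N.
Let P := PhiQ n.
Local Notation q := (f 'X).

Lemma PhiQ_dvd : P %| 'X^n - 1.
Proof.
have -> : 'X^n - 1 = map_poly intr ('X^n - 1 : {poly int}) :> {poly rat}.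
  by rewrite rmorphB rmorphXn rmorph1 /= map_polyX.
rewrite -prod_Cyclotomic // (big_rem n) ?divisors_id //=.
by rewrite rmorphM /= dvdp_mulr.
Qed.

Lemma PhiQ_dvd_sub u v : u = v %[mod n] -> P %| 'X^v - 'X^u.
Proof.
wlog uv : u v / (u <= v)%N => [hw|] /eqP.
  case: (leqP u v) => [uv /eqP|/ltnW vu /eqP /esym h]; first exact: hw.
  by rewrite -dvdpNr opprB; apply: hw.
rewrite eq_sym eqn_mod_dvd // => /dvdnP[k Hk].
rewrite -(subnKC uv) Hk exprD -[X in _ - X]mulr1 -mulrBr dvdp_mull //.
by rewrite mulnC exprM subrX1 dvdp_mulr // PhiQ_dvd.
Qed.

(** Over [algC] every root of Phi_n is a primitive n-th root of unity, whose powers of exponents [u]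
    and [v] agree only when u and v are congruent modulo n. *)
Lemma PhiQ_coprime_sub u v : u != v %[mod n] -> coprimep ('X^v - 'X^u) P.
Proof.
move=> uv; rewrite coprimep_sym -(coprimep_map (ratr : {rmorphism rat -> algC})).
have [z zP] := C_prim_root_exists n_gt0.
have -> : map_poly ratr P = cyclotomic z n :> {poly algC}.
  rewrite -(Cintr_Cyclotomic zP) -map_poly_comp; apply: eq_map_poly => i /=.
  exact: ratr_int.
apply/Pdiv.ClosedField.coprimepP => x; rewrite root_cyclotomic // => xP.
rewrite rmorphB !rmorphXn /= map_polyX !hornerE.
by rewrite subr_eq0 (eq_prim_root_expr xP) eq_sym.
Qed.

Lemma PhiQ_coprime_X : coprimep 'X P.
Proof.
apply: (coprimep_dvdl PhiQ_dvd).
rewrite coprimep_sym coprimepX /root !hornerE expr0n.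
by case: (n) n_gt0 => //= k _; rewrite sub0r oppr_eq0 oner_neq0.
Qed.

Lemma q_neq0 : q != 0.
Proof. by apply: fmorph_poly_neq0; rewrite polyX_eq0. Qed.

Lemma vunit_qX k : vunit P (q ^+ k).
Proof. by apply/vunitX/vunit_poly; [rewrite polyX_eq0 | apply: PhiQ_coprime_X]. Qed.

(** Negative powers of q arise from a = 1/q and 1/y. Writing each factor as 1 - q^u / q^v with
    natural exponents reduces its valuation to whether u and v agree modulo n. *)
Lemma one_sub_q u v : 1 - q ^+ u / q ^+ v = f ('X^v - 'X^u) / q ^+ v.
Proof.
by rewrite rmorphB !rmorphXn mulrBl divff ?expf_neq0 ?q_neq0.
Qed.

Lemma one_sub_q_neq0 u v : u != v -> 1 - q ^+ u / q ^+ v != 0.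
Proof.
move=> uv; rewrite one_sub_q mulf_neq0 ?invr_eq0 ?expf_neq0 ?q_neq0 //.
apply: fmorph_poly_neq0; rewrite subr_eq0; apply: contraNneq uv => /(congr1 (size \o polyseq)) /=.
by rewrite !size_polyXn => -[->].
Qed.

Lemma vunit_one_sub_q u v : u != v %[mod n] -> vunit P (1 - q ^+ u / q ^+ v).
Proof.
move=> uv; rewrite one_sub_q; apply: vunitM; last exact/vunitV/vunit_qX.
apply: vunit_poly; last exact: PhiQ_coprime_sub.
have : u != v by apply: contraNneq uv => ->.
rewrite subr_eq0; apply: contraNneq => /(congr1 (size \o polyseq)) /=.
by rewrite !size_polyXn => -[->].
Qed.

Lemma vge_one_sub_q u v : u = v %[mod n] -> vge P 1 (1 - q ^+ u / q ^+ v).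
Proof.
move=> /PhiQ_dvd_sub /dvdpP[w Hw]; rewrite one_sub_q Hw.
apply: vgeMr; last by apply/vunit_vge0/vunitV/vunit_qX.
by rewrite mulrC -{1}[P]expr1; apply: vge_poly.
Qed.

End Cyclotomic.

(** * The sum modulo the square of the cyclotomic polynomial *)

Local Notation q := (f 'X).

Lemma cyclotomic_square_sum (t r : nat) :
  let d := (2 * t.+2)%N in let n := (d * r.+1 + 1)%N in
  let a := q^-1 in let Q := q ^+ d in
  vge (PhiQ n) 2 (\sum_(k < n) (1 - a * Q ^+ (2 * k)) * poch _ a Q k ^+ d
     / poch _ Q Q k ^+ d * (Q ^+ t.+1 / a ^+ t.+2) ^+ k).
Proof.
move=> d n a Q; set P := PhiQ n.
(* Here r + 1 = (n-1)/d. The choice gives d M = E + 1 with n dividing E: thus Q^M = y/a exactly,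
   while y is 1 modulo Phi_n. *)
pose M := ((d - 1) * r.+1 + 1)%N; pose E := ((d - 1) * n)%N; pose y := q ^+ E.
have d2 : (2 < d)%N by rewrite /d; lia.
have d0 : (0 < d)%N by rewrite /d.
have n0 : (0 < n)%N by rewrite /n addn1.
have Mn : (M < n)%N by rewrite /M /n ltn_add2r ltn_pmul2r // ltn_subrL.
have dME : (d * M = E + 1)%N by rewrite /E /M /n /d; nia.
have nd : coprime n d by rewrite /n addn1 -addn1 mulnC /coprime gcdnC gcdnMDl gcdn1.
(* Since d is invertible modulo n, Phi_n divides no 1 - Q^(i+1) with i + 1 < n; this makes the
   denominators units. *)
have nmod i : (i.+1 < n)%N -> (d * i.+1)%N != 0 %[mod n].
  move=> i_n; rewrite mod0n -/(n %| d * i.+1)%N Gauss_dvdr //.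
  by apply/negP => /(dvdn_leq (ltn0Sn i)); rewrite leqNgt i_n.
have q0 := q_neq0.
have aE : a = 1 / q ^+ 1 by rewrite expr1 mul1r.
have QE i : Q * Q ^+ i = q ^+ (d * i.+1) / q ^+ 0.
  by rewrite -exprS -exprM expr0 divr1.
have aQE i : a * Q ^+ i = q ^+ (d * i) / q ^+ 1 by rewrite -exprM expr1 mulrC.
have Qy i : Q * y * Q ^+ i = q ^+ (d * i.+1 + E) / q ^+ 0.
  by rewrite mulrAC -exprS -exprM expr0 divr1 -exprD.
have Q'y i : Q / y * Q ^+ i = q ^+ (d * i.+1) / q ^+ E by rewrite mulrAC -exprS -exprM.
have yE : y = q ^+ E / q ^+ 0 by rewrite expr0 divr1.
have En : E = 0 %[mod n] by rewrite modnMl mod0n.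
have uqq k : vunit P (q ^+ k) by apply: vunit_qX.
have uQ : vunit P Q := uqq d.
have ua : vunit P a by apply: vunitV; have := uqq 1%N; rewrite expr1.
have uy : vunit P y := uqq E.
have vQ := vunit_vge0 _ _ uQ; have va := vunit_vge0 _ _ ua; have vy := vunit_vge0 _ _ uy.
have vy' := vunit_vge0 _ _ (vunitV _ _ uy); have va' := vunit_vge0 _ _ (vunitV _ _ ua).
have v1 := vge_one P.
have vQi i : vge P 0 (Q ^+ i) by apply: (@vgeX P 0).
have y1 : vge P 1 (1 - y) by rewrite yE; apply: vge_one_sub_q.
have uQQ k : (k < n)%N -> vunit P (poch _ Q Q k).
  move=> kn; apply: vunit_poch => i ik; rewrite QE; apply: vunit_one_sub_q => //.
  by apply: nmod; apply: leq_ltn_trans kn.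
have uQQy k : (k < n)%N -> vunit P (poch _ (Q * y) Q k).
  move=> kn; apply: vunit_poch => i ik; rewrite Qy; apply: vunit_one_sub_q => //.
  by rewrite -modnDmr En mod0n addn0; apply: nmod; apply: leq_ltn_trans kn.
have uQQ'y k : (k < n)%N -> vunit P (poch _ (Q / y) Q k).
  move=> kn; apply: vunit_poch => i ik; rewrite Q'y; apply: vunit_one_sub_q => //.
  by rewrite En; apply: nmod; apply: leq_ltn_trans kn.
have QM : Q ^+ M = y / a by rewrite -exprM dME exprD expr1 invrK.
have vw k : vge P 0 ((Q ^+ t.+1 / a ^+ t.+2) ^+ k).
  by apply: vunit_vge0; apply/vunitX/vunitM; [apply: vunitX | apply/vunitV/vunitX].
have vA k : vge P 0 (poch _ a Q k) by apply: vge_poch0.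
have vterm k : vge P 0 (1 - a * Q ^+ (2 * k)) by apply: vgeB => //; apply: vgeMl.
pose T2 k := (1 - a * Q ^+ (2 * k)) * poch _ a Q k ^+ (2 * t.+1)
     * (poch _ (a * y) Q k * poch _ (a / y) Q k)
     / (poch _ Q Q k ^+ (2 * t.+1) * (poch _ (Q * y) Q k * poch _ (Q / y) Q k))
     * (Q ^+ t.+1 / a ^+ t.+2) ^+ k.
pose T1 k := (1 - a * Q ^+ (2 * k)) * poch _ a Q k ^+ d
     / poch _ Q Q k ^+ d * (Q ^+ t.+1 / a ^+ t.+2) ^+ k.
have T12 k : (k <= M)%N -> vge P 2 (T1 k - T2 k).
  move=> kM; have kn := leq_ltn_trans kM Mn.
  have uD := uQQ k kn; have ur := vunitM _ _ _ (uQQy k kn) (uQQ'y k kn).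
  have uV j := vunit_vge0 _ _ (vunitV _ _ (vunitX _ _ j uD)).
  have [D0 _ _] := uD; have [r0 _ _] := ur.
  rewrite /T1 /T2 [d](_ : _ = 2 * t.+1 + 2)%N; last by rewrite /d; lia.
  rewrite diff_square_ratio //.
  apply: vgeMl; first by do ?[apply: vgeMl] => //; apply: (@vgeX P 0).
  apply: vgeMr; last first.
    by apply/vunit_vge0/vunitV/vunitM => //; apply: vunitX.
  apply: vgeD; first by apply: vgeMr; [apply: vge_poch_sym | apply: vunit_vge0].
  apply: vgeMl; first by apply: vgeMl; apply: vge_poch0 => //; apply: vgeMl.
  by rewrite -opprB; apply: vgeN; apply: vge_poch_sym.
have T2sum : vge P 2 (\sum_(k < M.+1) T2 k).
  rewrite /T2 chain_identity //; first last.
  - by case: uy.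
  - by case: ua.
  - by case: uQ.
  (* If d (i + 1) were E, then d would divide both E and E + 1 = d M. *)
  - move=> i; rewrite Q'y; apply: one_sub_q_neq0; apply/eqP => h.
    have : (d %| E + 1)%N by rewrite -dME dvdn_mulr.
    by rewrite -h (dvdn_addr _ (dvdn_mulr _ (dvdnn d))) dvdn1 gtn_eqF // ltnW.
  - by rewrite aE -[X in X / _](expr0 q); apply: one_sub_q_neq0.
  - move=> i; rewrite -mulrA -exprS aQE; apply: one_sub_q_neq0.
    by rewrite gtn_eqF // mulnS; apply: ltn_addr; apply: ltnW.
  - by move=> i; rewrite QE; apply: one_sub_q_neq0; rewrite muln_eq0 negb_or -lt0n d0.
  (* The last factor is 1 - a Q^M = 1 - y. *)
  have aQ1 : vge P 1 (poch _ (a * Q) Q M).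
    have MS : M.-1.+1 = M by rewrite /M addn1.
    apply: (vge_poch1 _ _ _ _ M.-1) => //; first exact: vgeMl.
    rewrite -mulrA -exprS MS aQE dME.
    by apply: vge_one_sub_q => //; rewrite -modnDml En mod0n.
  have b1 : vge P 1 (bailey_beta _ a (a * y) (Q / (a * y)) Q (chain_beta _ a Q t) M).
    have uay := vunitM _ _ _ ua uy; have vay := vunit_vge0 _ _ uay.
    have vl x : vunit P x -> vge P 0 (Q / x) by move=> ux; apply/vunit_vge0/vunitM/vunitV.
    have lb : Q / (a * y) * a = Q / y.
      by case: ua => a0 _ _; rewrite (mulrC a) invfM mulrA divfK.
    have lc : Q / (a * y) * (a * y) = Q by rewrite divfK //; case: uay.
    (* This makes [r] the increment of the threshold: the factor of index r of (Q/a;Q) is 1 - q^n,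
       and that of (Q/(ay);Q) is 1 - q^n / q^E. *)
    have Qn : Q / a * Q ^+ r = q ^+ n by rewrite invrK mulrAC -exprS -exprM -exprSr /n addn1.
    have nn : n = 0 %[mod n] by rewrite modnn mod0n.
    have uQQM j : (j <= M)%N -> vunit P (poch _ Q Q j).
      by move=> jM; apply: uQQ; apply: leq_ltn_trans Mn.
    apply: (proj2 (bailey_beta_vge P a (a * y) (Q / (a * y)) Q _ M r (t * r)
      _ _ _ _ _ _ _ M (leqnn M))) => //.
    - exact: vl.
    - rewrite invfM mulrA mulrAC Qn; apply: vge_one_sub_q => //; by rewrite nn En.
    - move=> j jM; rewrite lb lc; split; try exact: uQQM.
      by apply: uQQ'y; apply: leq_ltn_trans Mn.
    - apply: chain_beta_vge => //.
      by rewrite Qn -[q ^+ n]divr1 -(expr0 q); apply: vge_one_sub_q.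
    (* The t + 1 steps give the threshold (t + 1) r, which is below M because t + 1 <= d - 1. *)
    - rewrite /M -mulSnr addn1 ltnS leq_mul //; rewrite /d; lia.
  apply: (@vgeM P 1 1) => //; apply: vgeMl => //; apply: vgeMl; last exact/vunit_vge0/uQQ.
  exact: vgeB.
rewrite -(big_mkord xpredT T1) (big_cat_nat _ (n := M.+1)) //=; apply: vgeD.
  rewrite big_mkord -[X in vge P 2 X](subrK (\sum_(k < M.+1) T2 k)) -sumrB.
  by apply: vgeD => //; apply: vge_sum => k _; apply: T12; rewrite -ltnS.
(* For k > M the factorial (a;Q)_k contains 1 - a Q^M = 1 - y, and it enters to the power d >= 2. *)
rewrite big_nat; apply: vge_sum => k /andP[Mk kn].
apply: vgeMr => //; apply: vgeMr; last by apply/vunit_vge0/vunitV/vunitX/uQQ.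
apply: vgeMl => //; apply: (@vgeW P 2 (1 * d)); first by rewrite /d; lia.
apply: vgeX; apply: (vge_poch1 _ _ _ _ M) => //.
by rewrite QM mulrCA divff ?mulr1 //; case: ua.
Qed.

Lemma cyclotomic_square_sum_qint (d n : nat) :
  (4 <= d)%N -> ~~ odd d -> (1 < n)%N -> n = 1 %[mod d] ->
  vge (PhiQ n) 2 (\sum_(k < n) (1 - q ^ ((2 * d * k)%N%:Z - 1)) / (1 - q)
     * poch F q^-1 (q ^+ d) k ^+ d / poch F (q ^+ d) (q ^+ d) k ^+ d
     * q ^+ ((d * (d - 1) * k) %/ 2)).
Proof.
move=> d4 dodd n1 nd.
have [t Ht] : exists t, d = (2 * t.+2)%N.
  by exists (d./2 - 2)%N; have := odd_double_half d; rewrite (negbTE dodd); lia.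
have [r Hr] : exists r, n = (d * r.+1 + 1)%N.
  (* The quotient 0 is excluded by n > 1, so (n-1)/d has the form r + 1. *)
  have /dvdnP[[|k] Hk] : (d %| n - 1)%N by rewrite -eqn_mod_dvd ?nd // ltnW.
    by move: Hk; lia.
  by exists k; rewrite mulnC -Hk subnK // ltnW.
have H := cyclotomic_square_sum t r; rewrite /= -Ht -Hr in H.
have u1q : vunit (PhiQ n) (1 - q).
  have := vunit_one_sub_q n (ltnW n1) 1 0; rewrite expr1 expr0 divr1; apply.
  by rewrite mod0n modn_small.
have := vgeMl _ _ _ _ (vunit_vge0 _ _ (vunitV _ _ u1q)) H.
rewrite mulr_sumr; congr (vge _ _ _); apply: eq_bigr => k _.
have -> : q ^ ((2 * d * k)%N%:Z - 1) = q^-1 * (q ^+ d) ^+ (2 * k).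
  by rewrite expfzDr ?q_neq0 // mulrC -exprM mulnCA mulnA.
(* The division by 2 is exact: with d = 2(t + 2), d(d - 1) is twice d(t + 1) + t + 2. *)
have -> : ((q ^+ d) ^+ t.+1 / q^-1 ^+ t.+2) ^+ k = q ^+ ((d * (d - 1) * k) %/ 2).
  rewrite exprVn invrK -exprM -exprD -exprM; congr (_ ^+ _).
  have -> : (d * (d - 1) * k = (d * t.+1 + t.+2) * k * 2)%N.
    by rewrite Ht (_ : 2 * t.+2 - 1 = 2 * t + 3)%N; [ring | lia].
  by rewrite mulnK.
by rewrite !mulrA [(1 - q)^-1 * _]mulrC.
Qed.

End Localization.

(** * Transfer to the field of rational functions *)

Lemma tofrac_inj (R : idomainType) : injective (@FracField.tofrac R).
Proof. by move=> x y /eqP; rewrite tofrac_eq => /eqP. Qed.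

Lemma vge_cong_mod0 (P : {poly rat}) k x :
  vge RF (@FracField.tofrac {poly rat}) P k x -> cong_mod x 0 (P ^+ k).
Proof.
move=> [u [v [v0 cv hx]]]; exists (P ^+ k * u), v; split=> //.
- exact: coprimep_expr.
- by rewrite subr0.
- exact: dvdp_mulr.
Qed.

Theorem theorem3 (d n : nat) :
  (4 <= d)%N -> ~~ odd d -> (1 < n)%N -> n = 1 %[mod d] ->
  cong_mod
    (\sum_(k < n)
        qint ((2 * d * k)%N%:Z - 1)
        * (qpoch (qq ^-1) (qq ^+ d) k) ^+ d
        / (qpoch (qq ^+ d) (qq ^+ d) k) ^+ d
        * qq ^+ ((d * (d - 1) * k) %/ 2))
    0 (PhiQ n ^+ 2).
Proof.
move=> d4 dodd n1 nd; apply: vge_cong_mod0.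
(* With [f] the embedding of polynomials into fractions, [qq], [qint] and [qpoch] unfold to the
   expressions of the localized statement. *)
exact: (cyclotomic_square_sum_qint _ _ (@tofrac_inj {poly rat}) d n d4 dodd n1 nd).
Qed.
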